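(* Let $X$ be a $\mathcal{K}_4$-conjugation space (quaternionic conjugation space). Then $X$ is $\mathcal{K}_4$-maximal, that is, $$\sum_{i}\dim_{\mathbb{F}_2}H^i(X^{\mathcal{K}_4};\mathbb{F}_2)=\sum_{i}\dim_{\mathbb{F}_2}H^i(X;\mathbb{F}_2),$$ where the sums run over $0\le i\le\dim X^{\mathcal{K}_4}$ and $0\le i\le \dim X$ respectively (i.e. over all cohomological degrees).
   Context: $\mathcal{K}_4$ is the Klein four group; cohomology $H^*(-)$ and Borel cohomology $H^*_{\mathcal{K}_4}(X)=H^*(E\mathcal{K}_4\times_{\mathcal{K}_4}X)$ have $\mathbb{F}_2$ coefficients. Quaternionic conjugation space: a $\mathcal{K}_4$-space $X$ with $H^i(X)=0$ for $i\not\equiv 0\pmod 4$, together with (1) an additive isomorphism $\kappa\colon H^{4*}(X)\to H^*(X^{\mathcal{K}_4})$ dividing degrees by $4$; (2) an additive degree-preserving section $\sigma\colon H^*(X)\to H^*_{\mathcal{K}_4}(X)$ of the restriction $\rho\colon H^*_{\mathcal{K}_4}(X)\to H^*(X)$, such that for every $x\in H^{4n}(X)$ $$r(\sigma(x))=\kappa(x)p_0^{\,n}+\sum_{0<i+j\le n}\kappa_{i,j}(x)\,p_1^{\,j}p_0^{\,n-j-i}$$ (sum over $i,j\ge 0$) for some classes $\kappa_{i,j}(x)\in H^{n+3i+j}(X^{\mathcal{K}_4})$. Here $r\colon H^*_{\mathcal{K}_4}(X)\to H^*(X^{\mathcal{K}_4})\otimes H^*(B\mathcal{K}_4)$ is restriction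 to fixed points, $H^*(B\mathcal{K}_4)=\mathbb{F}_2[t,t']$ with $|t|=|t'|=1$, and $p_0=tt'(t+t')$, $p_1=t^2+tt'+t'^2$. The sums of dimensions are understood in $\{0,1,2,\dots\}\cup\{\infty\}$. *)

(* Defs.v *)
From HB Require Import structures.
From mathcomp Require Import all_fingroup.
From mathcomp Require Import all_boot all_order all_algebra.
From mathcomp Require Import all_classical all_reals all_analysis.
Set Implicit Arguments.
Unset Strict Implicit.
Unset Printing Implicit Defensive.
Import Order.TTheory GRing.Theory Num.Theory.
Import numFieldNormedType.Exports.
Local Open Scope classical_set_scope.
Local Open Scope ring_scope.

Section singular_simplices.
Variable R : realType.

Definition stdsimplex (n : nat) : set 'rV[R]_n.+1 :=
  [set x | (forall i, 0 <= x 0 i) /\ \sum_i x 0 i = 1].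
Arguments stdsimplex n : clear implicits.

(* The affine map Delta^m -> Delta^n sending the vertex e_i to e_(phi i).
   Only the values of phi on {0,...,m} matter, and they should be <= n. *)
Definition vertex_mx (m n : nat) (phi : nat -> nat) (x : 'rV[R]_m.+1)
    : 'rV[R]_n.+1 :=
  \row_j \sum_(i < m.+1 | inord (phi i) == j) x 0 i.

Lemma vertex_mx_simplex m n phi (x : stdsimplex m) :
  vertex_mx n phi (val x) \in stdsimplex n.
Proof.
have /set_mem [x0 x1] := valP x.
apply/mem_set; split=> [j|]; first by rewrite mxE sumr_ge0.
rewrite -x1 (eq_bigr _ (fun i _ => mxE _ _ _ _)) /=.
by rewrite (exchange_big_dep predT) //=; apply: eq_bigr => i _;
rewrite (big_pred1 (inord (phi i))) // => j; rewrite /= eq_sym.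
Qed.

Definition vertex_map (m n : nat) (phi : nat -> nat) (x : stdsimplex m)
    : stdsimplex n := SigSub (vertex_mx_simplex n phi x).

Lemma continuous_rV (T : topologicalType) n (f : T -> 'rV[R]_n) :
  (forall j, continuous (fun x => f x 0 j)) -> continuous f.
Proof.
move=> cf x A [P PA sPA].
have : \forall y \near x, forall i j, P i j (f y i j).
  apply: filter_forall => i; apply: filter_forall => j.
  by rewrite (ord1 i); apply: cf; rewrite -(ord1 i).
by apply: filterS => y Py; apply: sPA.
Qed.

Lemma continuous_bigsum (T : topologicalType) I (r : seq I) (P : pred I)
    (f : I -> T -> R) : (forall i, continuous (f i)) ->
  continuous (fun x => \sum_(i <- r | P i) f i x).
Proof.
move=> cf; elim: r => [|i r IHr] x.
  by under eq_fun do rewrite big_nil; exact: cvg_cst.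
under eq_fun do rewrite big_cons; case: (P i); last exact: IHr.
by apply: cvgD; [exact: cf|exact: IHr].
Qed.

Lemma vertex_map_continuous m n phi : continuous (@vertex_map m n phi).
Proof.
apply: continuous_comp_initial; apply: continuous_rV => j.
rewrite (_ : (fun x => _) = fun x : stdsimplex m =>
   \sum_(i < m.+1 | inord (phi i) == j :> 'I_n.+1) set_val x 0 i); last first.
  by apply/funext => x /=; rewrite mxE.
apply: continuous_bigsum => i.
move=> x; apply: (@continuous_comp _ _ _ (set_val : stdsimplex m -> _)
  (fun M : 'rV[R]_m.+1 => M 0 i)).
  exact: initial_continuous.
exact: coord_continuous.
Qed.

HB.instance Definition _ m n phi :=
  isContinuous.Build _ _ (@vertex_map m n phi) (@vertex_map_continuous m n phi).

Lemma eq_vertex_map m n phi psi : (forall i, (i <= m)%N -> phi i = psi i) ->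
  @vertex_map m n phi =1 @vertex_map m n psi.
Proof.
move=> e x; apply: val_inj => /=; apply/rowP => j; rewrite !mxE.
by apply: eq_bigl => i; rewrite e // -ltnS.
Qed.

Lemma vertex_map_id m : @vertex_map m m id =1 id.
Proof.
move=> x; apply: val_inj => /=; apply/rowP => j; rewrite mxE.
by rewrite (eq_bigl (pred1 j)) ?big_pred1_eq // => i; rewrite inord_val.
Qed.

Lemma vertex_map_comp k m n phi psi :
  (forall i, (i <= k)%N -> (psi i <= m)%N) ->
  @vertex_map m n phi \o @vertex_map k m psi =1 vertex_map n (phi \o psi).
Proof.
move=> psi_m x; apply: val_inj => /=; apply/rowP => j; rewrite !mxE.
rewrite (eq_bigr _ (fun i _ => mxE _ _ _ _)) /=.
rewrite (exchange_big_dep (fun i : 'I_k.+1 => inord (phi (psi i)) == j)) /=.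
  apply: eq_bigr => i /eqP <-.
  rewrite (big_pred1 (inord (psi i))) // => l /=; rewrite (eq_sym _ l).
  case: (eqVneq l (inord (psi i))) => [->|]; rewrite ?andbT ?andbF //.
  by rewrite inordK ?eqxx // ltnS psi_m // -ltnS.
by move=> l i /= + /eqP le; rewrite -le inordK // ltnS psi_m // -ltnS.
Qed.

Variable X : topologicalType.

Definition sing := {n : nat & continuousType (stdsimplex n) X}.

Definition simplex_dim (s : sing) : nat := tag s.

(* s o (the affine map Delta^m -> Delta^(simplex_dim s) given by phi) *)
Definition sing_sub (s : sing) (m : nat) (phi : nat -> nat) : sing :=
  Tagged (fun n => continuousType (stdsimplex n) X)
    (tagged s \o @vertex_map m (tag s) phi : continuousType _ _).

Lemma eq_sing_sub s m phi psi : (forall i, (i <= m)%N -> phi i = psi i) ->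
  sing_sub s m phi = sing_sub s m psi.
Proof.
move=> e; congr (existT _ m _); apply/continuousEP => x /=.
by rewrite (eq_vertex_map _ e).
Qed.

Lemma sing_sub_id s : sing_sub s (simplex_dim s) id = s.
Proof.
case: s => n s; congr (existT _ n _); apply/continuousEP => x /=.
by rewrite vertex_map_id.
Qed.

Lemma sing_sub_sub s m k phi psi : (forall i, (i <= k)%N -> (psi i <= m)%N) ->
  sing_sub (sing_sub s m phi) k psi = sing_sub s k (phi \o psi).
Proof.
move=> e; congr (existT _ k _); apply/continuousEP => x /=.
by rewrite -(vertex_map_comp _ _ e).
Qed.

End singular_simplices.
Arguments stdsimplex R n : clear implicits.

Lemma sum_triangle (V : nmodType) p (F : nat -> nat -> V) :
  \sum_(k < p.+1) \sum_(m < k.+1) F m k =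
  \sum_(m < p.+1) \sum_(l < (p - m).+1) F m (m + l)%N.
Proof.
rewrite -(big_mkord predT (fun k => \sum_(m < k.+1) F m k)).
under eq_bigr do rewrite -(big_mkord predT (fun m => F m _)).
transitivity (\sum_(0 <= k < p.+1) \sum_(0 <= m < p.+1 | (m <= k)%N) F m k).
  apply: eq_big_nat => k /andP[_ kp].
  by rewrite (big_nat_widen _ _ _ _ _ kp); apply: eq_bigl => m; rewrite ltnS.
rewrite (exchange_big_dep_nat predT) //= big_mkord; apply: eq_bigr => m _.
rewrite -(big_nat_widenl m 0 p.+1 predT) // -{1}[nat_of_ord m]add0n big_addn subSn -1?ltnS //.
by rewrite big_mkord; apply: eq_bigr => l _; rewrite addnC.
Qed.

Lemma bump_leqS i l m : (l <= m)%N -> (bump i l <= m.+1)%N.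
Proof. by rewrite /bump; case: (i <= l)%N => // /leqW. Qed.

Lemma F2_addrr (a : 'F_2) : a + a = 0.
Proof. by case: a => [[|[|//]] ?]; apply/val_inj. Qed.

Section cochains.
Variables (R : realType) (X : topologicalType).

(* Singular cochains with F_2 coefficients, all degrees at once. *)
Definition cochain : Type := sing R X -> 'F_2.
Implicit Types (f g h : cochain) (s : sing R X).

HB.instance Definition _ := GRing.Lmodule.copy cochain (sing R X -> ('F_2)^o).

Definition coboundary f : cochain := fun s =>
  if simplex_dim s is n.+1 then \sum_(i < n.+2) f (sing_sub s n (bump i))
  else 0.

(* Cup product: front m-face times back (p-m)-face, p being the dimension of
   the simplex. *)
Definition cup f g : cochain := fun s =>
  \sum_(m < (simplex_dim s).+1)
    f (sing_sub s m id) * g (sing_sub s (simplex_dim s - m) (addn m)).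

Definition cochain1 : cochain := fun s => (simplex_dim s == 0)%:R.

Lemma cupA : associative cup.
Proof.
move=> f g h; apply/funext => s; rewrite /cup.
pose F m k := f (sing_sub s m id) * g (sing_sub s (k - m) (addn m)) *
  h (sing_sub s (simplex_dim s - k) (addn k)).
transitivity (\sum_(m < (simplex_dim s).+1)
    \sum_(l < (simplex_dim s - m).+1) F m (m + l)%N).
  apply: eq_bigr => m _; rewrite mulr_sumr; apply: eq_bigr => l _.
  rewrite mulrA /F addKn subnDA; congr (_ * g _ * h _).
    by rewrite sing_sub_sub // => i il; rewrite (leq_trans il) // -ltnS.
  rewrite sing_sub_sub /= => [|i].
    by apply: eq_sing_sub => i _ /=; rewrite addnA.
  by rewrite -(leq_add2l l) subnKC // -ltnS.
rewrite -sum_triangle; apply: eq_bigr => k _; rewrite mulr_suml.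
apply: eq_bigr => m _; rewrite /F; congr (f _ * g _ * _).
  by rewrite sing_sub_sub // => i im; rewrite (leq_trans im) // -ltnS.
rewrite sing_sub_sub // => i; rewrite -(leq_add2l m) subnKC // -ltnS //.
Qed.

Lemma cup1f : left_id cochain1 cup.
Proof.
move=> f; apply/funext => s; rewrite /cup big_ord_recl big1 /= ?addr0.
  rewrite /cochain1 eqxx mul1r subn0 -[in RHS](sing_sub_id s).
  by congr (f _); apply: eq_sing_sub.
by move=> i _; rewrite /cochain1 mul0r.
Qed.

Lemma cupf1 : right_id cochain1 cup.
Proof.
move=> f; apply/funext => s; rewrite /cup big_ord_recr big1 /= ?add0r.
  by rewrite /cochain1 /= subnn eqxx mulr1 sing_sub_id.
by move=> i _; rewrite /cochain1 /= subn_eq0 leqNgt ltn_ord mulr0.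
Qed.

Lemma cupDl : left_distributive cup +%R.
Proof.
move=> f g h; apply/funext => s; rewrite /cup -[RHS]big_split /=.
by apply: eq_bigr => i _; rewrite mulrDl.
Qed.

Lemma cupDr : right_distributive cup +%R.
Proof.
move=> f g h; apply/funext => s; rewrite /cup -[RHS]big_split /=.
by apply: eq_bigr => i _; rewrite mulrDr.
Qed.

HB.instance Definition _ :=
  GRing.Zmodule_isPzRing.Build cochain cupA cup1f cupf1 cupDl cupDr.

Lemma coboundary_is_linear : linear coboundary.
Proof.
move=> a f g; apply/funext => s; rewrite /coboundary.
transitivity (a * coboundary f s + coboundary g s); last by [].
rewrite /coboundary; case: (simplex_dim s) => [|n]; first by rewrite mulr0 addr0.
by rewrite mulr_sumr -big_split.
Qed.

HB.instance Definition _ :=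
  GRing.isLinear.Build 'F_2 cochain cochain _ coboundary coboundary_is_linear.

Lemma coboundaryM f g :
  coboundary (f * g) = coboundary f * g + f * coboundary g.
Proof.
apply/funext => s.
transitivity (cup (coboundary f) g s + cup f (coboundary g) s); last by [].
rewrite {1}/coboundary /cup; case E: (simplex_dim s) => [|p].
  by rewrite !big_ord1 /= /coboundary /= ?E mul0r add0r mulr0.
pose A i m := f (sing_sub s m (bump i)).
pose A' m := f (sing_sub s m id).
pose B m := g (sing_sub s (p - m) (addn m.+1)).
pose B' m i := g (sing_sub s (p - m) (addn m \o bump i.+1)).
transitivity (\sum_(m < p.+1)
   ((\sum_(i < m.+1) A i m) * B m + A' m * \sum_(i < (p - m).+1) B' m i)).
  transitivity (\sum_(i < p.+2) \sum_(m < p.+1)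
      f (sing_sub (sing_sub s p (bump i)) m id) *
      g (sing_sub (sing_sub s p (bump i)) (p - m) (addn m))); first by [].
  rewrite exchange_big /=; apply: eq_bigr => m _.
  have mp : (m <= p)%N by rewrite -ltnS.
  have -> : p.+2 = (m.+1 + (p - m).+1)%N by rewrite addSn addnS subnKC.
  rewrite big_split_ord /= mulr_suml mulr_sumr; congr (_ + _).
    apply: eq_bigr => i _; rewrite !sing_sub_sub /=.
    - congr (_ * g _); apply: eq_sing_sub => l _ /=.
      by rewrite /bump (leq_trans _ (leq_addr _ _)) ?addSn // -ltnS.
    - by move=> l lp; rewrite -[leqRHS](subnKC mp) leq_add2l.
    - by move=> l lm; rewrite (leq_trans lm).
  apply: eq_bigr => i _; rewrite !sing_sub_sub /=.
  - congr (f _ * g _); apply: eq_sing_sub => l l_le /=.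
      by rewrite /bump leqNgt (leq_ltn_trans l_le) ?add0n // leq_addr.
    by rewrite /bump addSn -addnS leq_add2l addnCA.
  - by move=> l lp; rewrite -[leqRHS](subnKC mp) leq_add2l.
  - by move=> l lm; rewrite (leq_trans lm).
have -> : \sum_(k < p.+2) coboundary f (sing_sub s k id) *
    g (sing_sub s (p.+1 - k) (addn k)) =
    \sum_(m < p.+1) (\sum_(i < m.+1) A i m * B m + A' m * B m).
  rewrite big_ord_recl mul0r add0r; apply: eq_bigr => m _.
  rewrite /coboundary /= -mulr_suml -mulrDl subSS; congr (_ * _).
  rewrite big_ord_recr /=; congr (_ + _).
    apply: eq_bigr => i _; rewrite sing_sub_sub // => l lm.
    exact: bump_leqS.
  rewrite sing_sub_sub => [|l lm]; last exact: bump_leqS.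
  by congr (f _); apply: eq_sing_sub => l lm /=; rewrite /bump ltnNge lm.
have -> : \sum_(m < p.+2) f (sing_sub s m id) *
    coboundary g (sing_sub s (p.+1 - m) (addn m)) =
    \sum_(m < p.+1) (A' m * B m + A' m * \sum_(i < (p - m).+1) B' m i).
  rewrite big_ord_recr /= subnn [X in _ + X]mulr0 addr0; apply: eq_bigr => m _.
  have mp : (m <= p)%N by rewrite -ltnS.
  rewrite -mulrDr /coboundary /= subSn //; congr (_ * _).
  rewrite big_ord_recl /=; congr (_ + _).
    rewrite sing_sub_sub => [|l lm]; last exact: bump_leqS.
    by congr (g _); apply: eq_sing_sub => l _ /=; rewrite /bump leq0n addnS addSn.
  apply: eq_bigr => i _; rewrite sing_sub_sub // => l lm.
  exact: bump_leqS.
rewrite -big_split /=; apply: eq_bigr => m _.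
by rewrite -mulr_suml addrA -(addrA (_ * B m)) F2_addrr addr0.
Qed.

Lemma coboundary1 : coboundary 1 = 0.
Proof. by have := coboundaryM 1 1; rewrite !mul1r mulr1 => /eqP;
rewrite -subr_eq0 opprD addrA subrr sub0r oppr_eq0 => /eqP. Qed.

End cochains.

Section cohomology.
Variables (R : realType) (X : topologicalType).
Local Notation cochain := (cochain R X).

(* Elements of the direct sum of the C^n(X), as opposed to their product. *)
Definition finite_cochain (f : cochain) : Prop :=
  exists N, forall s, (N <= simplex_dim s)%N -> f s = 0.

Lemma finite_cochainD f g :
  finite_cochain f -> finite_cochain g -> finite_cochain (f + g).
Proof.
move=> [N fN] [M gM]; exists (maxn N M) => s; rewrite geq_max => /andP[Ns Ms].
by rewrite -[LHS]/(f s + g s) fN // gM // addr0.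
Qed.

Lemma finite_cochainZ a f : finite_cochain f -> finite_cochain (a *: f).
Proof. by move=> [N fN]; exists N => s Ns; rewrite -[LHS]/(a * f s) fN // mulr0. Qed.

Lemma finite_cochainB f g :
  finite_cochain f -> finite_cochain g -> finite_cochain (f - g).
Proof.
by move=> ff fg; rewrite -scaleN1r; exact/finite_cochainD/finite_cochainZ.
Qed.

Lemma finite_cochainM f g :
  finite_cochain f -> finite_cochain g -> finite_cochain (f * g).
Proof.
move=> [N fN] [M gM]; exists (N + M)%N => s NMs.
rewrite -[LHS]/(cup f g s); apply: big1 => m _.
have [Nm|mN] := leqP N m; first by rewrite fN ?mul0r.
rewrite gM ?mulr0 //= leq_subRL; last by rewrite -ltnS.
by apply: leq_trans NMs; rewrite leq_add2r ltnW.
Qed.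

Lemma finite_cochain0 : finite_cochain 0.
Proof. by exists 0%N. Qed.

Lemma finite_cochain1 : finite_cochain 1.
Proof.
by exists 1%N => s s0; rewrite -[LHS]/(cochain1 s) /cochain1 eqn0Ngt s0.
Qed.

Definition is_cocycle : {pred cochain} :=
  fun f => `[< finite_cochain f /\ coboundary f = 0 >].

Lemma is_cocycle_subring : subring_closed is_cocycle.
Proof.
split=> [|f g /asboolP[ff df] /asboolP[fg dg]|f g /asboolP[ff df] /asboolP[fg dg]];
  apply/asboolP; split.
- exact: finite_cochain1.
- exact: coboundary1.
- exact: finite_cochainB.
- by rewrite linearB /= df dg subrr.
- exact: finite_cochainM.
- by rewrite coboundaryM df dg mul0r mulr0 addr0.
Qed.

Lemma is_cocycle_scale : GRing.scaler_closed is_cocycle.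
Proof.
move=> a f /asboolP[ff df]; apply/asboolP.
by split; [exact: finite_cochainZ|rewrite linearZ /= df scaler0].
Qed.

HB.instance Definition _ :=
  GRing.isSubringClosed.Build cochain is_cocycle is_cocycle_subring.
HB.instance Definition _ :=
  GRing.isScaleClosed.Build 'F_2 cochain is_cocycle is_cocycle_scale.

Definition cocycle : Type := {f : cochain | f \in is_cocycle}.

HB.instance Definition _ := SubChoice.on cocycle.
HB.instance Definition _ := GRing.SubChoice_isSubPzRing.Build cochain
  is_cocycle cocycle is_cocycle_subring.
HB.instance Definition _ := [SubZmodule_isSubLmodule of cocycle by <:].

Lemma cocycle_finite (z : cocycle) : finite_cochain (val z).
Proof. by have /asboolP[] := valP z. Qed.

Lemma cocycleP (z : cocycle) : coboundary (val z) = 0.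
Proof. by have /asboolP[] := valP z. Qed.

Definition is_coboundary : {pred cocycle} :=
  fun z => `[< exists2 g, finite_cochain g & val z = coboundary g >].

Lemma is_coboundary_zmod : zmod_closed is_coboundary.
Proof.
split=> [|z w /asboolP[g fg zE] /asboolP[h fh wE]]; apply/asboolP.
  by exists 0; [exact: finite_cochain0|rewrite linear0 raddf0].
by exists (g - h); [exact: finite_cochainB|rewrite raddfB /= zE wE linearB].
Qed.

HB.instance Definition _ :=
  GRing.isZmodClosed.Build cocycle is_coboundary is_coboundary_zmod.

Lemma is_coboundaryMl z w : w \in is_coboundary -> z * w \in is_coboundary.
Proof.
move=> /asboolP[g fg wE]; apply/asboolP; exists (val z * g).
  by apply: finite_cochainM => //; exact: cocycle_finite.
by rewrite rmorphM /= coboundaryM cocycleP mul0r add0r wE.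
Qed.

Lemma is_coboundaryMr z w : z \in is_coboundary -> z * w \in is_coboundary.
Proof.
move=> /asboolP[g fg zE]; apply/asboolP; exists (g * val w).
  by apply: finite_cochainM => //; exact: cocycle_finite.
by rewrite rmorphM /= coboundaryM cocycleP mulr0 addr0 zE.
Qed.

Lemma is_coboundaryZ a z : z \in is_coboundary -> a *: z \in is_coboundary.
Proof.
move=> /asboolP[g fg zE]; apply/asboolP; exists (a *: g).
  exact: finite_cochainZ.
by rewrite [RHS]linearZ linearZ /= zE.
Qed.

Definition cohomology : Type := Quotient.quot is_coboundary.

HB.instance Definition _ := GRing.Zmodule.on cohomology.

Local Open Scope quotient_scope.

Definition class : cocycle -> cohomology := \pi_(Quotient.quot is_coboundary).

Lemma classP z w : reflect (class z = class w) (z - w \in is_coboundary).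
Proof. by rewrite Quotient.idealrBE; exact: eqP. Qed.

Lemma class_repr (x : cohomology) : class (repr x) = x.
Proof. exact: reprK. Qed.

Lemma classB : zmod_morphism class.
Proof. exact: (@raddfB _ _ \pi_(Quotient.quot is_coboundary)). Qed.

HB.instance Definition _ :=
  GRing.isZmodMorphism.Build cocycle cohomology class classB.

Definition cohomology_mul (x y : cohomology) : cohomology :=
  class (repr x * repr y).

Definition cohomology_scale (a : 'F_2) (x : cohomology) : cohomology :=
  class (a *: repr x).

Lemma class_mul z w : cohomology_mul (class z) (class w) = class (z * w).
Proof.
apply/classP; set z' := repr (class z); set w' := repr (class w).
have /classP dz : class z' = class z by exact: class_repr.
have /classP dw : class w' = class w by exact: class_repr.
rewrite (_ : _ - _ = (z' - z) * w' + z * (w' - w)); last first.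
  by rewrite mulrBl mulrBr addrA subrK.
by apply: rpredD; [exact: is_coboundaryMr|exact: is_coboundaryMl].
Qed.

Lemma class_scale a z : cohomology_scale a (class z) = class (a *: z).
Proof.
apply/classP; rewrite -scalerBr; apply: is_coboundaryZ; apply/classP.
exact: class_repr.
Qed.

Lemma cohomology_mulA : associative cohomology_mul.
Proof.
move=> x y z; rewrite -[x]class_repr -[y]class_repr -[z]class_repr.
by rewrite !class_mul mulrA.
Qed.

Lemma cohomology_mul1 : left_id (class 1) cohomology_mul.
Proof. by move=> x; rewrite -[x]class_repr class_mul mul1r. Qed.

Lemma cohomology_mulr1 : right_id (class 1) cohomology_mul.
Proof. by move=> x; rewrite -[x]class_repr class_mul mulr1. Qed.

Lemma cohomology_mulDl : left_distributive cohomology_mul +%R.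
Proof.
move=> x y z; rewrite -[x]class_repr -[y]class_repr -[z]class_repr.
by rewrite -raddfD !class_mul mulrDl raddfD.
Qed.

Lemma cohomology_mulDr : right_distributive cohomology_mul +%R.
Proof.
move=> x y z; rewrite -[x]class_repr -[y]class_repr -[z]class_repr.
by rewrite -raddfD !class_mul mulrDr raddfD.
Qed.

HB.instance Definition _ := GRing.Zmodule_isPzRing.Build cohomology
  cohomology_mulA cohomology_mul1 cohomology_mulr1
  cohomology_mulDl cohomology_mulDr.

Lemma cohomology_scaleA a b x :
  cohomology_scale a (cohomology_scale b x) = cohomology_scale (a * b) x.
Proof. by rewrite -[x]class_repr !class_scale scalerA. Qed.

Lemma cohomology_scale1 : left_id 1 cohomology_scale.
Proof. by move=> x; rewrite -[x]class_repr class_scale scale1r. Qed.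

Lemma cohomology_scaleDr : right_distributive cohomology_scale +%R.
Proof.
move=> a x y; rewrite -[x]class_repr -[y]class_repr.
by rewrite -raddfD !class_scale scalerDr raddfD.
Qed.

Lemma cohomology_scaleDl x : {morph cohomology_scale^~ x : a b / a + b}.
Proof.
by move=> a b; rewrite -[x]class_repr !class_scale scalerDl raddfD.
Qed.

HB.instance Definition _ := GRing.Zmodule_isLmodule.Build 'F_2 cohomology
  cohomology_scaleA cohomology_scale1 cohomology_scaleDr cohomology_scaleDl.

Lemma class_is_scalable : scalable class.
Proof. by move=> a z; rewrite -class_scale. Qed.

Lemma class_is_monoid_morphism : monoid_morphism class.
Proof. by split=> // z w; rewrite -class_mul. Qed.

HB.instance Definition _ :=
  GRing.isScalable.Build 'F_2 cocycle cohomology _ class class_is_scalable.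
HB.instance Definition _ := GRing.isMonoidMorphism.Build cocycle cohomology
  class class_is_monoid_morphism.

Definition homogeneous (n : nat) : set cohomology :=
  [set x | exists2 z : cocycle,
     class z = x & forall s, simplex_dim s != n -> val z s = 0].

End cohomology.
Arguments cohomology R X : clear implicits.
Arguments homogeneous R X n : clear implicits.

Section pullback.
Variables (R : realType) (X Y : topologicalType) (f : continuousType X Y).

Definition sing_map (s : sing R X) : sing R Y :=
  Tagged (fun n => continuousType (stdsimplex R n) Y)
    (f \o tagged s : continuousType _ _).

Definition cochain_pullback (c : cochain R Y) : cochain R X :=
  fun s => c (sing_map s).

Lemma sing_map_sub s m phi :
  sing_sub (sing_map s) m phi = sing_map (sing_sub s m phi).
Proof. by congr (existT _ m _); apply/continuousEP. Qed.

Lemma cochain_pullback_is_linear : linear cochain_pullback.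
Proof. by []. Qed.

Lemma cochain_pullback_is_monoid_morphism : monoid_morphism cochain_pullback.
Proof.
split=> // c e; apply/funext => s.
rewrite -[LHS]/(cup c e (sing_map s)) -[RHS]/(cup _ _ s) /cup.
by apply: eq_bigr => m _; rewrite !sing_map_sub.
Qed.

HB.instance Definition _ := GRing.isLinear.Build 'F_2 (cochain R Y)
  (cochain R X) _ cochain_pullback cochain_pullback_is_linear.
HB.instance Definition _ := GRing.isMonoidMorphism.Build (cochain R Y)
  (cochain R X) cochain_pullback cochain_pullback_is_monoid_morphism.

Lemma coboundary_pullback c :
  coboundary (cochain_pullback c) = cochain_pullback (coboundary c).
Proof.
apply/funext => -[n s]; rewrite /coboundary /cochain_pullback /=.
by case: n s => // n s; apply: eq_bigr => i _; rewrite sing_map_sub.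
Qed.

Lemma finite_cochain_pullback c :
  finite_cochain c -> finite_cochain (cochain_pullback c).
Proof. by move=> [N cN]; exists N => s; exact: (cN (sing_map s)). Qed.

Lemma cocycle_pullback_subproof (z : cocycle R Y) :
  cochain_pullback (val z) \in @is_cocycle R X.
Proof.
apply/asboolP; split; first exact/finite_cochain_pullback/cocycle_finite.
by rewrite coboundary_pullback cocycleP linear0.
Qed.

Definition cocycle_pullback (z : cocycle R Y) : cocycle R X :=
  Sub (cochain_pullback (val z)) (cocycle_pullback_subproof z).

Definition pullback (x : cohomology R Y) : cohomology R X :=
  class (cocycle_pullback (repr x)).

Lemma pullback_class z : pullback (class z) = class (cocycle_pullback z).
Proof.
apply/classP; set w := repr _.
have /classP/asboolP[g fg wzE] : class w = class z by exact: class_repr.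
apply/asboolP; exists (cochain_pullback g); first exact: finite_cochain_pullback.
by rewrite coboundary_pullback -wzE !raddfB.
Qed.

Lemma pullback_is_linear : linear pullback.
Proof.
move=> a x y; rewrite -[x]class_repr -[y]class_repr.
rewrite -linearP !pullback_class -linearP.
by congr class; apply: val_inj.
Qed.

Lemma pullback_is_monoid_morphism : monoid_morphism pullback.
Proof.
split=> [|x y].
  rewrite -(rmorph1 (@class R Y)) pullback_class -(rmorph1 (@class R X)).
  by congr class; apply: val_inj.
rewrite -[x]class_repr -[y]class_repr -rmorphM !pullback_class -rmorphM.
by congr class; apply: val_inj; exact: (rmorphM cochain_pullback).
Qed.

HB.instance Definition _ := GRing.isLinear.Build 'F_2 (cohomology R Y)
  (cohomology R X) _ pullback pullback_is_linear.
HB.instance Definition _ := GRing.isMonoidMorphism.Build (cohomology R Y)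
  (cohomology R X) pullback pullback_is_monoid_morphism.

End pullback.

(* The library proves these only for actions on a finType. *)
Section total_action.
Variables (G : finGroupType) (Y : Type) (to : {action G &-> Y}).

Lemma tactM x g h : to x (g * h)%g = to (to x g) h.
Proof. by case: to => f [/= _ fM]; rewrite fM ?inE. Qed.

Lemma tact1 x : to x 1%g = x.
Proof.
have to_inj : injective (to^~ 1%g) by case: to => f [].
by apply: to_inj; rewrite -tactM mulg1.
Qed.

Lemma tactK x g : to (to x g) g^-1%g = x.
Proof. by rewrite -tactM mulgV tact1. Qed.

End total_action.

Section orbit_spaces.
Variables (G : finGroupType) (Y : topologicalType) (to : {action G &-> Y}).

Definition orbit_rel : rel Y := fun x y => [exists g : G, to x g == y].

Lemma orbit_rel_equiv : equiv_class_of orbit_rel.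
Proof.
split=> [x|x y|y x z].
- by apply/existsP; exists 1%g; rewrite tact1.
- by apply/existsP/existsP => -[g /eqP <-]; exists g^-1%g; rewrite tactK.
- move=> /existsP[g /eqP <-] /existsP[h /eqP <-]; apply/existsP.
  by exists (g * h)%g; rewrite tactM.
Qed.

Canonical orbit_rel_equivRel := EquivRelPack orbit_rel_equiv.
Canonical orbit_rel_encModRel := defaultEncModRel orbit_rel.

Local Open Scope quotient_scope.

Local Notation Q := (quotient_topology {eq_quot orbit_rel}).

Definition orbit_space : Type := Q.
HB.instance Definition _ := Topological.on orbit_space.

Definition orbit_pi : Y -> orbit_space := \pi_Q.

Lemma orbit_pi_continuous : continuous orbit_pi.
Proof. exact: pi_continuous. Qed.

HB.instance Definition _ :=
  isContinuous.Build Y orbit_space orbit_pi orbit_pi_continuous.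

Lemma orbit_piP x y : reflect (orbit_pi x = orbit_pi y) (orbit_rel x y).
Proof. exact: eqmodP. Qed.

Lemma orbit_pi_repr (q : orbit_space) : orbit_pi (repr q) = q.
Proof. exact: reprK. Qed.

(* The map Y/G -> Z induced by a G-invariant map Y -> Z. *)
Section orbit_lift.
Variables (Z : topologicalType) (f : continuousType Y Z).
Hypothesis f_inv : forall y g, f (to y g) = f y.

Definition orbit_lift_fun (q : orbit_space) : Z := f (repr q).

Lemma orbit_lift_pi y : orbit_lift_fun (orbit_pi y) = f y.
Proof.
have /orbit_piP/existsP[g /eqP yE] := orbit_pi_repr (orbit_pi y).
by rewrite -[in RHS]yE f_inv.
Qed.

Lemma orbit_lift_continuous : continuous orbit_lift_fun.
Proof.
apply/(@quotient_continuous _ {eq_quot orbit_rel}).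
rewrite (_ : _ \o _ = f); first exact: cts_fun.
by apply/funext => y; exact: orbit_lift_pi.
Qed.

Definition orbit_lift : continuousType orbit_space Z :=
  mkcts orbit_lift_continuous.

End orbit_lift.

End orbit_spaces.

(* The map Y/G -> Y'/G' induced by a map Y -> Y' equivariant along
   phi : G -> G'. *)
Section orbit_map.
Variables (G G' : finGroupType) (Y Y' : topologicalType).
Variables (to : {action G &-> Y}) (to' : {action G' &-> Y'}).
Variables (phi : G -> G') (f : continuousType Y Y').
Hypothesis f_equi : forall y g, f (to y g) = to' (f y) (phi g).

Lemma orbit_map_inv y g :
  (orbit_pi to' \o f) (to y g) = (orbit_pi to' \o f) y.
Proof.
apply/esym/orbit_piP/existsP; exists (phi g); exact/eqP/esym/f_equi.
Qed.

Definition orbit_map : continuousType (orbit_space to) (orbit_space to') :=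
  orbit_lift orbit_map_inv.

End orbit_map.

Section sphere.
Variable R : realType.

(* The unit sphere of R^oo. Its topology is that of coordinatewise
   convergence, which on the sphere agrees with the l^2-metric topology, and
   which is that of Milnor's infinite join of copies of Z/2. *)
Definition sphere_oo : set {ptws nat -> R} :=
  [set x | exists2 N, forall i, (N <= i)%N -> x i = 0
                    & \sum_(i < N) x i ^+ 2 = 1].

Lemma antipode_sphere (x : sphere_oo) (a : 'Z_2) :
  (fun i => (-1) ^+ a * val x i : R) \in sphere_oo.
Proof.
have /set_mem [N xN x1] := valP x; apply/mem_set; exists N.
  by move=> i Ni; rewrite xN // mulr0.
by rewrite -[RHS]x1; apply: eq_bigr => i _; rewrite exprMn sqrr_sign mul1r.
Qed.

Definition antipode (x : sphere_oo) (a : 'Z_2) : sphere_oo :=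
  SigSub (antipode_sphere x a).

Lemma antipode1 : antipode^~ 1%g =1 id.
Proof. by move=> x; apply: val_inj; apply/funext => i /=; rewrite mul1r. Qed.

Lemma antipodeM x : act_morph antipode x.
Proof.
move=> a b; apply: val_inj; apply/funext => i /=; rewrite mulrA; congr (_ * _).
by case: a b => [[|[|//]] ?] [[|[|//]] ?]; rewrite /= ?expr0 ?expr1 ?mulr1 ?mul1r ?mulrNN ?mulr1.
Qed.

Definition antipodal_action : {action 'Z_2 &-> sphere_oo} :=
  TotalAction antipode1 antipodeM.

Lemma sphere_base_mem : (fun i => (i == 0)%:R : R) \in sphere_oo.
Proof.
apply/mem_set; exists 1%N; last by rewrite big_ord1 expr1n.
by case.
Qed.

Definition sphere_base : sphere_oo := SigSub sphere_base_mem.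

End sphere.
Arguments sphere_oo R : clear implicits.

Definition K4 : finGroupType := ('Z_2 * 'Z_2)%type.

Section product_action.
Variables (G : finGroupType) (Y Z : topologicalType).
Variables (to : {action G &-> Y}) (to' : {action G &-> Z}).

Definition diag_act (p : Y * Z) (g : G) : Y * Z := (to p.1 g, to' p.2 g).

Lemma diag_act1 : diag_act^~ 1%g =1 id.
Proof. by move=> [y z]; rewrite /diag_act !tact1. Qed.

Lemma diag_actM p : act_morph diag_act p.
Proof. by move=> g h; rewrite /diag_act !tactM. Qed.

Definition diag_action : {action G &-> (Y * Z)%type} :=
  TotalAction diag_act1 diag_actM.

End product_action.

Section trivial_action.
Variables (G : finGroupType) (Y : Type).

Definition triv_act (y : Y) (_ : G) : Y := y.

Lemma triv_act1 : triv_act^~ 1%g =1 id. Proof. by []. Qed.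
Lemma triv_actM y : act_morph triv_act y. Proof. by []. Qed.

Definition trivial_action : {action G &-> Y} :=
  TotalAction triv_act1 triv_actM.

End trivial_action.

Lemma fst_continuous (Y Z : topologicalType) : continuous (@fst Y Z).
Proof. by move=> p; exact: cvg_fst. Qed.

Lemma snd_continuous (Y Z : topologicalType) : continuous (@snd Y Z).
Proof. by move=> p; exact: cvg_snd. Qed.

Lemma pair_cst_continuous (Y Z : topologicalType) (y : Y) :
  continuous (fun z : Z => (y, z)).
Proof. by move=> z; apply: cvg_pair; [exact: cvg_cst|exact: cvg_id]. Qed.

Lemma pair_incl_continuous (Y Z : topologicalType) (A : set Z) :
  continuous (fun p : Y * A => (p.1, set_val p.2)).
Proof.
move=> p; apply: cvg_pair; first exact: cvg_fst.
apply: (@continuous_comp _ _ _ snd (set_val : A -> Z)); first exact: cvg_snd.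
exact: initial_continuous.
Qed.

Section borel.
Variable R : realType.

(* E(K4) = S^oo x S^oo, each factor of K4 acting antipodally on one factor. *)
Definition EK4 : Type := (sphere_oo R * sphere_oo R)%type.
HB.instance Definition _ := Topological.on EK4.

Definition EK4_act (e : EK4) (g : K4) : EK4 :=
  (antipodal_action R e.1 g.1, antipodal_action R e.2 g.2).

Lemma EK4_act1 : EK4_act^~ 1%g =1 id.
Proof. by move=> [x y]; rewrite /EK4_act !tact1. Qed.

Lemma EK4_actM e : act_morph EK4_act e.
Proof. by move=> g h; rewrite /EK4_act !tactM. Qed.

Definition EK4_action : {action K4 &-> EK4} := TotalAction EK4_act1 EK4_actM.

Definition EK4_base : EK4 := (sphere_base R, sphere_base R).

Definition BK4 : topologicalType := orbit_space EK4_action.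
Definition RP_oo : topologicalType := orbit_space (antipodal_action R).

Definition BK4_fst : continuousType BK4 RP_oo :=
  @orbit_map _ _ _ _ EK4_action (antipodal_action R) fst
    (mkcts (@fst_continuous (sphere_oo R) (sphere_oo R))) (fun _ _ => erefl).
Definition BK4_snd : continuousType BK4 RP_oo :=
  @orbit_map _ _ _ _ EK4_action (antipodal_action R) snd
    (mkcts (@snd_continuous (sphere_oo R) (sphere_oo R))) (fun _ _ => erefl).

(* H^1(RP^oo) = F_2; this is its nonzero element. *)
Definition RP_oo_generator : cohomology R RP_oo :=
  xget 0 [set w | homogeneous R RP_oo 1 w /\ w <> 0].

(* H^*(BK4) = F_2[t, t'] *)
Definition t_cls : cohomology R BK4 := pullback BK4_fst RP_oo_generator.
Definition t'_cls : cohomology R BK4 := pullback BK4_snd RP_oo_generator.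

Definition p0_cls : cohomology R BK4 := t_cls * t'_cls * (t_cls + t'_cls).
Definition p1_cls : cohomology R BK4 :=
  t_cls ^+ 2 + t_cls * t'_cls + t'_cls ^+ 2.

Section space.
Variables (X : topologicalType) (to : {action K4 &-> X}).

Definition borel : topologicalType := orbit_space (diag_action EK4_action to).

Definition fiber_incl : continuousType X borel :=
  orbit_pi (diag_action EK4_action to) \o mkcts (@pair_cst_continuous EK4 X EK4_base).

(* rho : H^*_K4(X) -> H^*(X), restriction to a fibre of EK4 x_K4 X -> BK4 *)
Definition rho : cohomology R borel -> cohomology R X :=
  pullback fiber_incl.

Definition fixed_points : set X := [set x | forall g, to x g = x].

End space.

Section fixed.
Variables (X : topologicalType) (to : {action K4 &-> X}).
Local Notation XK := (fixed_points to).

(* EK4 x_K4 X^K4, which is BK4 x X^K4 *)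
Definition borel_fixed : topologicalType := borel (trivial_action K4 XK).

Definition fixed_incl : continuousType (EK4 * XK)%type (EK4 * X)%type :=
  mkcts (@pair_incl_continuous EK4 X XK).

Lemma fixed_incl_equi (p : EK4 * XK) (g : K4) :
  fixed_incl (diag_action EK4_action (trivial_action K4 XK) p g)
  = diag_action EK4_action to (fixed_incl p) (id g).
Proof. by congr pair => /=; rewrite (set_mem (valP p.2)). Qed.

(* Restriction to the fixed points, with values in H^*_K4(X^K4) *)
Definition restr_fixed : cohomology R (borel to) -> cohomology R borel_fixed :=
  pullback (orbit_map fixed_incl_equi).

Definition borel_fixed_fst : continuousType borel_fixed BK4 :=
  @orbit_map _ _ _ _ (diag_action EK4_action (trivial_action K4 XK)) EK4_action
    id (mkcts (@fst_continuous EK4 XK)) (fun _ _ => erefl).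

Definition borel_fixed_snd : continuousType borel_fixed XK :=
  @orbit_lift _ _ (diag_action EK4_action (trivial_action K4 XK)) _
    (mkcts (@snd_continuous EK4 XK)) (fun _ _ => erefl).

(* The Kunneth isomorphism H^*(X^K4) (x) H^*(BK4) -> H^*_K4(X^K4), on pure
   tensors. *)
Definition cross (a : cohomology R XK) (b : cohomology R BK4)
    : cohomology R borel_fixed :=
  pullback borel_fixed_snd a * pullback borel_fixed_fst b.

End fixed.
End borel.

(* The dimension of a subspace A, in {0, 1, 2, ...} u {+oo}. *)
Definition dimension (R : realType) (K : fieldType) (V : lmodType K)
    (A : set V) : \bar R :=
  ereal_sup [set (k%:R)%:E | k in [set k : nat |
    exists2 v : 'I_k -> V, forall i, A (v i) &
      forall c : 'I_k -> K, \sum_i c i *: v i = 0 -> forall i, c i = 0]].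

Section conjugation_space.
Variables (R : realType) (X : topologicalType) (to : {action K4 &-> X}).
Local Notation XK := (fixed_points to).

(* Since H^*(X) is concentrated in degrees divisible by 4, H^{4*}(X) is the
   whole of H^*(X). The restriction r to the fixed points is expressed in
   H^*_K4(X^K4), which cross identifies with H^*(X^K4) (x) H^*(BK4). *)
Record quaternionic_conjugation := QuaternionicConjugation {
  cohomology_vanish : forall i, (i %% 4 != 0)%N ->
    homogeneous R X i = [set 0];
  kappa : {additive cohomology R X -> cohomology R XK};
  kappa_bij : forall n,
    set_bij (homogeneous R X (4 * n)) (homogeneous R XK n) kappa;
  sigma : {additive cohomology R X -> cohomology R (borel R to)};
  sigma_degree : forall n x, homogeneous R X n x ->
    homogeneous R (borel R to) n (sigma x);
  sigma_section : forall x, rho (sigma x) = x;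
  conjugation_equation : forall n x, homogeneous R X (4 * n) x ->
    exists2 kappa_ : nat -> nat -> cohomology R XK,
      forall i j, (0 < i + j <= n)%N ->
        homogeneous R XK (n + 3 * i + j) (kappa_ i j) &
      restr_fixed (sigma x) =
        cross (kappa x) (p0_cls R ^+ n) +
        \sum_(i < n.+1) \sum_(j < n.+1 | (0 < i + j <= n)%N)
          cross (kappa_ i j) (p1_cls R ^+ j * p0_cls R ^+ (n - j - i))
}.

End conjugation_space.
Arguments quaternionic_conjugation R {X} to.

(* Main.v *)
Require Import Defs.
From mathcomp Require Import all_fingroup.
From mathcomp Require Import all_boot all_order all_algebra.
From mathcomp Require Import all_classical all_reals all_analysis.
Import Order.TTheory GRing.Theory.
Local Open Scope classical_set_scope.
Local Open Scope ring_scope.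
Local Open Scope ereal_scope.

(** The isomorphism [kappa] carries all the information that is needed: it
    identifies [H^(4n)(X)] with [H^n(X^K4)] for every [n], so these two spaces
    have the same dimension. The cohomology of [X] vanishes in the remaining
    degrees, so summing over all [n] counts every class of [X] exactly once;
    since dimensions are nonnegative, the terms of the series may be reindexed
    by [i = 4n] even if the total dimension is infinite.

    Two points deserve care. The map [kappa] is only given as an additive map,
    but over the prime field every additive map is linear
    ([additive_F2_scalable]). And it is bijective one degree at a time, so its
    injectivity may only be applied to linear combinations that stay in one
    degree; this is why [dimension_bij] asks for the source to be closed under
    linear combinations. *)

Lemma additive_F2_scalable (U V : lmodType 'F_2) (f : {additive U -> V}) :
  scalable f.
Proof. by move=> a x; rewrite -[a]natr_Zp !scaler_nat raddfMn. Qed.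

Section dimension.
Variables (R : realType) (K : fieldType).

Lemma dimension_ge0 (V : lmodType K) (A : set V) : 0 <= dimension R A.
Proof.
(* The empty family is independent. *)
apply: ereal_sup_ubound; exists 0%N => //.
by exists (fun=> 0%R) => [[]|c _ []].
Qed.

Lemma dimension_set0 (V : lmodType K) : dimension R [set (0 : V)%R] = 0.
Proof.
apply/eqP; rewrite eq_le dimension_ge0 andbT; apply: ge_ereal_sup.
move=> _ [[|k] [v v0 free_v] <-] //.
have : (1 : K)%R = 0%R.
  apply: (free_v (fun=> 1%R) _ ord0).
  by rewrite big1 // => i _; rewrite v0 scaler0.
by move/eqP; rewrite oner_eq0.
Qed.

(** Independent families go forward along [f] because [f] is injective on the
    combinations of their members, and lift back along [f] because any relation
    between the lifts is mapped to a relation between the original vectors. *)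
Lemma dimension_bij (U V : lmodType K) (A : set U) (B : set V)
    (f : {additive U -> V}) :
  A 0%R -> (forall a x y, A x -> A y -> A (a *: x + y)%R) ->
  scalable f -> set_bij A B f -> dimension R A = dimension R B.
Proof.
move=> A0 A_linear fZ [fAB f_inj f_surj].
have f_comb k (c : 'I_k -> K) (v : 'I_k -> U) :
    f (\sum_i c i *: v i)%R = (\sum_i c i *: f (v i))%R.
  by rewrite raddf_sum; apply: eq_bigr => i _; exact: fZ.
congr ereal_sup; apply/seteqP; split=> _ [k [v vA free_v] <-]; exists k => //.
- exists (f \o v) => [i|c]; first exact: fAB.
  rewrite -f_comb -(raddf0 f) => fv0; apply: free_v; apply: f_inj fv0.
    apply/mem_set; elim/big_rec: _ => // i x _; exact: A_linear.
  exact/mem_set.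
- have /boolp.choice[w wP] : forall i, exists u, A u /\ f u = v i.
    by move=> i; have [u Au fu] := f_surj _ (vA i); exists u.
  exists w => [i|c cw0]; first by have [] := wP i.
  apply: free_v; rewrite -[RHS](raddf0 f) -cw0 f_comb.
  by apply: eq_bigr => i _; have [_ ->] := wP i.
Qed.

End dimension.

Section homogeneous.
Variables (R : realType) (X : topologicalType) (n : nat).

Lemma homogeneous0 : homogeneous R X n 0%R.
Proof. by exists 0%R => //; exact: raddf0. Qed.

Lemma homogeneous_linear a x y :
  homogeneous R X n x -> homogeneous R X n y ->
  homogeneous R X n (a *: x + y)%R.
Proof.
move=> [z <- zn] [w <- wn]; exists (a *: z + w)%R; first by rewrite linearP.
move=> s sn; rewrite linearP /=.
by rewrite -[LHS]/(a * val z s + val w s)%R zn // wn // mulr0 addr0.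
Qed.

End homogeneous.

Lemma nneseries_dvdn (R : realType) (d : nat) (a : (\bar R)^nat) :
  (0 < d)%N -> (forall i, 0 <= a i) -> (forall i, ~~ (d %| i)%N -> a i = 0) ->
  \sum_(0 <= i <oo) a i = \sum_(0 <= i <oo) a (d * i)%N.
Proof.
move=> d_gt0 a_ge0 a0.
transitivity (\sum_(0 <= i <oo | (d %| i)%N) a i).
  rewrite [RHS]eseries_mkcond; apply: eq_eseriesr => i _.
  by case: ifPn => // /a0.
rewrite nneseries_esum // nneseries_esumT //.
apply: reindex_esum; split=> [i _|i j _ _|_ /dvdnP[i ->]].
- exact: dvdn_mulr.
- by move=> /eqP; rewrite eqn_pmul2l // => /eqP.
- by exists i; rewrite // mulnC.
Qed.

Theorem proposition5p1 (R : realType) (X : topologicalType)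
    (to : {action K4 &-> X}) (to_continuous : forall g : K4, continuous (to^~ g))
    (QX : quaternionic_conjugation R to) :
  \sum_(0 <= i <oo) dimension R (homogeneous R (fixed_points to) i) =
  \sum_(0 <= i <oo) dimension R (homogeneous R X i).
Proof.
rewrite [RHS](@nneseries_dvdn _ 4) // => [|i|i i4]; last 2 first.
- exact: dimension_ge0.
- by rewrite (cohomology_vanish QX) ?dimension_set0.
apply: eq_eseriesr => n _; apply/esym.
apply: (@dimension_bij _ _ _ _ _ _ (kappa QX)).
- exact: homogeneous0.
- exact: homogeneous_linear.
- exact: additive_F2_scalable.
- exact: kappa_bij.
Qed.
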